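(* Let $0<\widetilde\omega_1<\widetilde\omega_2$ and let $1<\mu\le 2+\sqrt3$. The value of $p>0$ that minimizes $\max_{\widetilde\omega_1\le\widetilde\omega\le\widetilde\omega_2}\rho(\widetilde\omega,p)$ over all $p>0$ is $$p^*=\sqrt{2\mu\,\widetilde\omega_1\widetilde\omega_2}.$$
   Context: Here $\mu=\sqrt{\nu_1/\nu_2}$ is the square root of the ratio of two diffusion coefficients $\nu_1,\nu_2>0$, and it is assumed throughout that $\mu>1$. The interval $[\widetilde\omega_1,\widetilde\omega_2]$, $0<\widetilde\omega_1<\widetilde\omega_2$, is the frequency range ($\widetilde\omega_1=\sqrt{\pi/(4T)}$, $\widetilde\omega_2=\sqrt{\pi/(2\Delta t)}$ for a final time $T$ and a time step $\Delta t$). For $\widetilde\omega>0$ and $p>0$, the convergence factor is $$\rho(\widetilde\omega,p)=\sqrt{\frac{(p-\widetilde\omega)^2+\widetilde\omega^2}{(p+\mu\widetilde\omega)^2+\mu^2\widetilde\omega^2}\cdot\frac{(p-\mu\widetilde\omega)^2+\mu^2\widetilde\omega^2}{(p+\widetilde\omega)^2+\widetilde\omega^2}}.$$ *)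

(* Defs.v *)
From mathcomp Require Import all_boot all_order all_algebra.
From mathcomp Require Import all_classical all_reals all_analysis.

Set Implicit Arguments.
Unset Strict Implicit.
Unset Printing Implicit Defensive.

Import Order.TTheory GRing.Theory Num.Theory.
Import numFieldNormedType.Exports.

Local Open Scope classical_set_scope.
Local Open Scope ring_scope.

Definition rho (R : realType) (mu w p : R) : R :=
  Num.sqrt
    (((p - w) ^+ 2 + w ^+ 2) / ((p + mu * w) ^+ 2 + mu ^+ 2 * w ^+ 2)
     * (((p - mu * w) ^+ 2 + mu ^+ 2 * w ^+ 2) / ((p + w) ^+ 2 + w ^+ 2))).

(* For p > 0 this supremum is a genuine maximum; see max_rho_attained. *)
Definition max_rho (R : realType) (mu w1 w2 p : R) : R :=
  sup [set rho mu w p | w in `[w1, w2]].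

Lemma rho_continuous (R : realType) (mu p : R) :
  0 < p -> continuous (fun w => rho mu w p).
Proof.
move=> p0 w.
have den (a : R) : (p + a) ^+ 2 + a ^+ 2 != 0.
  rewrite gt_eqF// lt_neqAle addr_ge0 ?sqr_ge0// andbT eq_sym.
  rewrite paddr_eq0 ?sqr_ge0// !expf_eq0 /=; apply/negP => /andP[/eqP h /eqP a0].
  by move: h; rewrite a0 addr0 => h; rewrite h ltxx in p0.
have cr (f : R -> R) : {for w, continuous f} ->
    {for w, continuous (fun x : R => Num.sqrt (f x) : R)}.
  by move=> cf; apply: (continuous_comp cf); exact: sqrt_continuous.
apply: cr.
have ci : {for w, continuous (fun w : R => w)} by [].
have cc (c : R) : {for w, continuous (fun=> c : R)} by exact: cst_continuous.
have cs (f : R -> R) : {for w, continuous f} ->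
    {for w, continuous (fun x : R => f x ^+ 2)}.
  by move=> cf; apply: continuousM.
have cm : {for w, continuous (fun x : R => mu * x)} by exact: continuousM.
have cm2 : {for w, continuous (fun x : R => mu ^+ 2 * x ^+ 2)}.
  by apply: continuousM => //; exact: cs.
apply: continuousM; apply: continuousM.
- apply: continuousD; last exact: cs.
  by apply: cs; exact: continuousB.
- apply: continuousV; first by rewrite -exprMn den.
  apply: continuousD => //.
  by apply: cs; exact: continuousD.
- apply: continuousD => //.
  by apply: cs; exact: continuousB.
- apply: continuousV; first exact: den.
  apply: continuousD; last exact: cs.
  by apply: cs; exact: continuousD.
Qed.

Lemma max_rho_attained (R : realType) (mu w1 w2 p : R) :
  w1 <= w2 -> 0 < p ->
  (exists2 w, w \in `[w1, w2]%R & max_rho mu w1 w2 p = rho mu w p) /\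
  (forall w, w \in `[w1, w2]%R -> rho mu w p <= max_rho mu w1 w2 p).
Proof.
move=> w12 p0.
have [c cI cmax] := EVT_max w12 (continuous_subspaceT (@rho_continuous _ mu _ p0)).
have ub : ubound [set rho mu w p | w in `[w1, w2]] (rho mu c p).
  by move=> _ [w wI <-]; exact: cmax.
have le_max w : w \in `[w1, w2]%R -> rho mu w p <= max_rho mu w1 w2 p.
  by move=> wI; apply: ub_le_sup; [exists (rho mu c p)|exists w].
split=> //; exists c => //; apply/eqP; rewrite eq_le le_max// andbT.
by apply: ge_sup => //; exists (rho mu c p), c.
Qed.

(* Main.v *)
Require Import Defs.
From mathcomp Require Import all_boot all_order all_algebra.
From mathcomp Require Import all_classical all_reals all_analysis.
From mathcomp Require Import ring lra.

Import Order.TTheory GRing.Theory Num.Theory.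
Local Open Scope classical_set_scope.
Local Open Scope ring_scope.

(** The convergence factor depends on [(w, p)] only through the ratio
    [t = p / w], and on [t] only through [s = balance t = t + 2 mu / t]:
    dividing numerator and denominator of [rho ^+ 2] by [t ^+ 2] gives
    (lemma [rhoE])
      [rho ^+ 2 = (s ^+ 2 + A - B s) / (s ^+ 2 + A + B s)]
    with [A = 2 (1 + mu ^+ 2)] and [B = 2 (1 + mu)].  This quotient increases
    with [s + A / s], hence with [s] as soon as [s ^+ 2 >= A].  By AM-GM
    [s ^+ 2 >= 8 mu], and [8 mu >= A] is [mu ^+ 2 - 4 mu + 1 <= 0], which for
    [1 < mu] is exactly [mu <= 2 + sqrt 3].  So minimizing the maximum of [rho]
    amounts to minimizing the maximum of [s] ([lt_rho], [le_rho]).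

    The map [balance] is invariant under [t |-> 2 mu / t] and increases to the
    right of the fixed point [sqrt (2 mu)] of this involution.  For the [p] with
    [p ^+ 2 = 2 mu w1 w2] the involution exchanges the two endpoint ratios
    [p / w1] and [p / w2], so [s] is maximal, with equal values, at both ends of
    the frequency interval ([max_rho_balanced]).  A larger [p] strictly increases
    [s] at [w1], and a smaller one strictly increases [s] at [w2]
    ([max_rho_unbalanced]); this yields optimality and uniqueness at once. *)

Section ConvergenceFactor.
Set Implicit Arguments.
Unset Strict Implicit.
Variables (R : realType) (mu : R).
Hypothesis mu_gt1 : 1 < mu.

Let mu_gt0 : 0 < mu. Proof. exact: lt_trans mu_gt1. Qed.

Definition balance (t : R) : R := t + 2 * mu / t.

Definition balance_factor (s : R) : R :=
  (s ^+ 2 + 2 * (1 + mu ^+ 2) - 2 * (1 + mu) * s)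
  / (s ^+ 2 + 2 * (1 + mu ^+ 2) + 2 * (1 + mu) * s).

Lemma balance_inv (t : R) : 0 < t -> balance (2 * mu / t) = balance t.
Proof.
by move=> t0; rewrite /balance; field; rewrite !gt_eqF.
Qed.

Lemma balance_gt0 (t : R) : 0 < t -> 0 < balance t.
Proof. by move=> t0; rewrite addr_gt0// divr_gt0// mulr_gt0. Qed.

Lemma balance_sqr_ge (t : R) : 0 < t -> 8 * mu <= balance t ^+ 2.
Proof.
move=> t0; rewrite -subr_ge0.
have -> : balance t ^+ 2 - 8 * mu = (t - 2 * mu / t) ^+ 2.
  by rewrite /balance; field; rewrite gt_eqF.
exact: sqr_ge0.
Qed.

(** The last factor is the reason why [t u] versus [2 mu] decides monotonicity:
    [2 mu <= t u] says that [u] dominates the mirror image [2 mu / t] of [t], a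
    condition that needs no square root of [2 mu]. *)
Lemma balanceB (t u : R) : 0 < t -> 0 < u ->
  balance u - balance t = (u - t) * ((t * u - 2 * mu) / (t * u)).
Proof. by move=> t0 u0; rewrite /balance; field; rewrite !gt_eqF. Qed.

Lemma balance_le (t u : R) : 0 < t -> t <= u -> 2 * mu <= t * u ->
  balance t <= balance u.
Proof.
move=> t0 tu h; have u0 := lt_le_trans t0 tu.
by rewrite -subr_ge0 balanceB// !(mulr_ge0, invr_ge0, subr_ge0)// ltW.
Qed.

Lemma balance_lt (t u : R) : 0 < t -> t < u -> 2 * mu < t * u ->
  balance t < balance u.
Proof.
move=> t0 tu h; have u0 := lt_trans t0 tu.
by rewrite -subr_gt0 balanceB// !(mulr_gt0, invr_gt0, subr_gt0).
Qed.

Lemma rhoE (w p : R) : 0 < w -> 0 < p ->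
  rho mu w p = Num.sqrt (balance_factor (balance (p / w))).
Proof.
move=> w0 p0; rewrite /rho /balance_factor /balance; congr Num.sqrt.
have mw0 : 0 < mu * w by rewrite mulr_gt0.
by field; rewrite !gt_eqF// !(addr_gt0, mulr_gt0, exprn_gt0).
Qed.

(** The numerator stays positive because its discriminant in [s] is
    [- 4 (mu - 1) ^+ 2]. *)
Lemma balance_factor_gt0 (s : R) : 0 < s -> 0 < balance_factor s.
Proof.
move=> s0; apply: divr_gt0; last by have := mulr_gt0 mu_gt0 s0; nra.
have -> : s ^+ 2 + 2 * (1 + mu ^+ 2) - 2 * (1 + mu) * s
        = (s - (1 + mu)) ^+ 2 + (mu - 1) ^+ 2 by ring.
by rewrite ltr_wpDl ?sqr_ge0// exprn_gt0// subr_gt0.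
Qed.

(** Cross-multiplying, the difference of the two sides is
    [4 (1 + mu) (u - s) (s u - 2 (1 + mu ^+ 2))]. *)
Lemma balance_factor_lt (s u : R) :
  0 < s -> 2 * (1 + mu ^+ 2) <= s ^+ 2 -> s < u ->
  balance_factor s < balance_factor u.
Proof.
move=> s0 As su; have u0 := lt_trans s0 su.
have den v : 0 < v -> 0 < v ^+ 2 + 2 * (1 + mu ^+ 2) + 2 * (1 + mu) * v.
  by move=> v0; have := mulr_gt0 mu_gt0 v0; nra.
rewrite /balance_factor ltr_pdivrMr ?den// [ltRHS]mulrAC ltr_pdivlMr ?den//.
rewrite -subr_gt0.
have Asu : 2 * (1 + mu ^+ 2) < s * u.
  by rewrite (le_lt_trans As)// expr2 ltr_pM2l.
set e := (X in 0 < X).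
have -> : e = 4 * (1 + mu) * (u - s) * (s * u - 2 * (1 + mu ^+ 2)).
  by rewrite /e; ring.
by rewrite !mulr_gt0 ?subr_gt0 ?addr_gt0.
Qed.

Hypothesis mu_le : mu <= 2 + Num.sqrt 3.

(** The only use of the upper bound on [mu]: it puts every value of [balance]
    in the range where [balance_factor] increases. *)
Lemma monotone_threshold_le : 2 * (1 + mu ^+ 2) <= 8 * mu.
Proof.
(* The bound is [0 <= (2 + r - mu) (mu - (2 - r))] for [r = sqrt 3];
   the second factor is positive because [2 - r <= 1 < mu]. *)
have r3 : Num.sqrt 3 ^+ 2 = 3 :> R by rewrite sqr_sqrtr.
have : 1 <= Num.sqrt 3 :> R by rewrite -[leLHS]sqrtr1 ler_wsqrtr// ler1n.
by move: (Num.sqrt 3) r3 mu_le mu_gt1 => r r3 h1 h2 h3; nra.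
Qed.

Lemma lt_rho (w p v q : R) : 0 < w -> 0 < p -> 0 < v -> 0 < q ->
  balance (p / w) < balance (q / v) -> rho mu w p < rho mu v q.
Proof.
move=> w0 p0 v0 q0 h; have pw0 := divr_gt0 p0 w0; have qv0 := divr_gt0 q0 v0.
rewrite !rhoE// ltr_sqrt ?balance_factor_gt0 ?balance_gt0//.
apply: balance_factor_lt h; first exact: balance_gt0.
exact: le_trans monotone_threshold_le (balance_sqr_ge pw0).
Qed.

Lemma le_rho (w p v q : R) : 0 < w -> 0 < p -> 0 < v -> 0 < q ->
  balance (p / w) <= balance (q / v) -> rho mu w p <= rho mu v q.
Proof.
move=> w0 p0 v0 q0; rewrite le_eqVlt => /predU1P[h|h].
  by rewrite !rhoE// h.
by rewrite ltW// lt_rho.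
Qed.

Variables w1 w2 : R.
Hypotheses (w1_gt0 : 0 < w1) (w12 : w1 < w2).

Let w2_gt0 : 0 < w2. Proof. exact: lt_trans w12. Qed.

Variable p : R.
Hypotheses (p_gt0 : 0 < p) (p_sqr : p ^+ 2 = 2 * mu * w1 * w2).

(** Every ratio [p / w] lies between [p / w2] and [p / w1], which are mirror
    images of each other for this [p]; hence both [p / w] and its mirror image
    are at most [p / w1]. *)
Lemma max_rho_balanced : max_rho mu w1 w2 p <= rho mu w1 p.
Proof.
have [[w /[!in_itv]/= /andP[w1w ww2] ->] _] :=
  max_rho_attained mu (ltW w12) p_gt0.
have w0 := lt_le_trans w1_gt0 w1w.
apply: le_rho => //; apply: balance_le; first exact: divr_gt0.
  by rewrite ler_pM2l// lef_pV2 ?posrE.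
have -> : p / w * (p / w1) = 2 * mu * (w2 / w).
  have -> : p / w * (p / w1) = p ^+ 2 / (w * w1).
    by field; rewrite !gt_eqF.
  by rewrite p_sqr; field; rewrite !gt_eqF.
by rewrite ler_pMr ?mulr_gt0// ler_pdivlMr// mul1r.
Qed.

(** For [q] below [p] the endpoint that gets worse is [w2]; the involution
    [t |-> 2 mu / t] turns the ratio there into [2 mu w2 / q], which lies to the
    right of [p / w1], so both cases are covered by the same monotonicity. *)
Lemma max_rho_unbalanced (q : R) : 0 < q -> q != p ->
  rho mu w1 p < max_rho mu w1 w2 q.
Proof.
move=> q0; have [_ le_max] := max_rho_attained mu (ltW w12) q0.
have t0 : 0 < p / w1 by exact: divr_gt0.
have t2 : 2 * mu < (p / w1) ^+ 2.
  have -> : (p / w1) ^+ 2 = 2 * mu * (w2 / w1).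
    by rewrite expr_div_n p_sqr; field; rewrite gt_eqF.
  by rewrite ltr_pMr ?mulr_gt0// ltr_pdivlMr// mul1r.
have beyond u : p / w1 < u -> balance (p / w1) < balance u.
  move=> tu; apply: balance_lt => //.
  by apply: lt_trans t2 _; rewrite expr2 ltr_pM2l.
rewrite neq_lt => /orP[qp|pq].
- apply: (@lt_le_trans _ _ (rho mu w2 q)); last first.
    by apply: le_max; rewrite in_itv/= lexx ltW.
  apply: lt_rho => //; rewrite -(balance_inv (divr_gt0 q0 w2_gt0)).
  apply: beyond.
  have -> : 2 * mu / (q / w2) = p ^+ 2 / (w1 * q).
    by rewrite p_sqr; field; rewrite !gt_eqF.
  have -> : p ^+ 2 / (w1 * q) = p / w1 * (p / q).
    by field; rewrite !gt_eqF.
  by rewrite ltr_pMr// ltr_pdivlMr// mul1r.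
- apply: (@lt_le_trans _ _ (rho mu w1 q)); last first.
    by apply: le_max; rewrite in_itv/= lexx ltW.
  by apply: lt_rho => //; apply: beyond; rewrite ltr_pM2r ?invr_gt0.
Qed.

End ConvergenceFactor.

Theorem theorem3p2 (R : realType) (mu w1 w2 : R)
    (hw1 : 0 < w1) (hw12 : w1 < w2)
    (hmu1 : 1 < mu) (hmu2 : mu <= 2 + Num.sqrt 3) :
  [set p : R | 0 < p /\
     forall q : R, 0 < q -> max_rho mu w1 w2 p <= max_rho mu w1 w2 q]
  = [set Num.sqrt (2 * mu * w1 * w2)].
Proof.
have w2_gt0 := lt_trans hw1 hw12.
have mu_gt0 : 0 < mu by exact: lt_trans hmu1.
have prod_gt0 : 0 < 2 * mu * w1 * w2 by rewrite !mulr_gt0.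
have p_gt0 : 0 < Num.sqrt (2 * mu * w1 * w2) by rewrite sqrtr_gt0.
have p_sqr := sqr_sqrtr (ltW prod_gt0).
have best := max_rho_balanced hmu1 hmu2 hw1 hw12 p_gt0 p_sqr.
have worse := max_rho_unbalanced hmu1 hmu2 hw1 hw12 p_gt0 p_sqr.
apply/seteqP; split=> [q [q0 qmin]|_ ->] /=.
  apply/eqP/negPn/negP => qp.
  have := le_lt_trans best (worse q q0 qp).
  by rewrite ltNge qmin.
split=> // q q0; have [->//|qp] := eqVneq q (Num.sqrt (2 * mu * w1 * w2)).
by rewrite ltW// (le_lt_trans best)// worse.
Qed.
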